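(* Let $(S,\cdot)$ be a weak commutative semigroup, let $\sim$ be a congruence of $S$ such that $S/\!\sim$ is a left-zero semigroup, and let $\mathcal{G}$ be a subgroup of $\mathrm{Aut}(S,\cdot)$ whose action on $S$ is semi-regular. Let $S_1,\dots,S_r$ be the orbits of this action and let $\mathcal{T}=\{T_1,\dots,T_m\}$ be the partition of $S$ induced by $\sim$. Assume that every $S_i$ is a set of representatives of $S/\!\sim$ and that $\mathcal{T}$ is a system of blocks of $\mathcal{G}$. Choose $T\in\mathcal{T}$ and let $\theta:S\to\mathcal{G}$, $x\mapsto\theta_x$, be the map given by $\theta_t:=\mathrm{id}_S$ and $\theta_{g(t)}:=g^{-1}$ for all $t\in T$ and $g\in\mathcal{G}$. Then the map $s:S\times S\to S\times S$ given by $s(x,y):=(x\cdot y,\theta_x(y))$ gives rise to a commutative non-degenerate solution $(S,s)$.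
   Context: A solution (set-theoretic solution of the Pentagon Equation) is a pair $(S,s)$ with $S$ a non-empty set and $s:S\times S\to S\times S$ a map such that $s_{23}s_{13}s_{12}=s_{12}s_{23}$ as maps $S^3\to S^3$, where $s_{12}=s\times \mathrm{id}$, $s_{23}=\mathrm{id}\times s$, $s_{13}=(\tau\times \mathrm{id})(\mathrm{id}\times s)(\tau\times \mathrm{id})$ and $\tau(x,y)=(y,x)$. Writing $s(x,y)=(x\cdot y,\theta_x(y))$, the pair $(S,s)$ is a solution if and only if for all $x,y,z\in S$: $(x\cdot y)\cdot z=x\cdot(y\cdot z)$, $\theta_x(y)\cdot\theta_{x\cdot y}(z)=\theta_x(y\cdot z)$, and $\theta_{\theta_x(y)}\theta_{x\cdot y}=\theta_y$. It is commutative if $s_{12}s_{13}=s_{13}s_{12}$, equivalently $x\cdot y\cdot z=x\cdot z\cdot y$ and $\theta_{x\cdot y}=\theta_x$ for all $x,y,z\in S$. It is non-degenerate if every $\theta_x:S\to S$ is bijective. A semigroup is weak commutative if $x\cdot y\cdot z=x\cdot z\cdot y$ for all $x,y,z$; it is left-zero if $x\cdot y=x$ for all $x,y$. A permutation group on $S$ is semi-regular if every point of $S$ has trivial stabilizer. If a group $G$ acts on $S$, a subset $B\subseteq S$ is a block if for each $g\in G$ the set $g(B)$ either equals $B$ or is disjoint from $B$; a partition of $S$ is a system of blocks if each of its members is a block. ''$S_i$ is a set of representatives of $S/\!\sim$'' means $S_i$ contains exactly one element of each $\sim$-class. *)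

(* Defs.v *)
From HB Require Import structures.
From mathcomp Require Import all_boot.
From mathcomp Require Import boolp classical_sets.
Set Implicit Arguments.
Unset Strict Implicit.
Unset Printing Implicit Defensive.
Local Open Scope classical_set_scope.
Local Open Scope group_scope.

Section Pentagon.
Variables (S : Type) (s : S * S -> S * S).

Definition tau (p : S * S) : S * S := (p.2, p.1).

(* [S * S * S] is [(S * S) * S], so [id \x f] needs a reassociation. *)
Definition pair_id (f : S * S -> S * S) (p : S * S * S) : S * S * S :=
  (f p.1, p.2).
Definition id_pair (f : S * S -> S * S) (p : S * S * S) : S * S * S :=
  let q := f (p.1.2, p.2) in (p.1.1, q.1, q.2).

Definition s12 := pair_id s.
Definition s23 := id_pair s.
Definition s13 := pair_id tau \o id_pair s \o pair_id tau.

Definition pentagon_solution : Prop :=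
  inhabited S /\ s23 \o s13 \o s12 =1 s12 \o s23.

Definition commutative_solution : Prop := s12 \o s13 =1 s13 \o s12.

(* [y |-> (s (x, y)).2] is the map [theta_x]. *)
Definition nondegenerate_solution : Prop :=
  forall x, bijective (fun y => (s (x, y)).2).

End Pentagon.

Definition weak_commutative (S : semigroupType) : Prop :=
  forall x y z : S, x * y * z = x * z * y.

Section Congruence.
Variables (S : semigroupType) (R : S -> S -> Prop).

Definition congruence : Prop :=
  RelationClasses.Equivalence R /\
  forall x x' y y' : S, R x x' -> R y y' -> R (x * y) (x' * y').

Definition eq_class (x : S) : set S := [set y | R x y].

Definition eq_classes : set (set S) := range eq_class.

(* The class containing all the products of an element of [A] by an element
   of [B]; see [quot_mulE]. *)
Definition quot_mul (A B : set S) : set S :=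
  [set z | exists a b, [/\ A a, B b & R (a * b) z]].

Lemma quot_mulE : congruence ->
  forall x y, quot_mul (eq_class x) (eq_class y) = eq_class (x * y).
Proof.
move=> [[Rr Rs Rt] Rm] x y; rewrite eqEsubset; split=> z /=.
  by move=> [a [b [xa yb abz]]]; apply: Rt (Rm _ _ _ _ xa yb) abz.
by move=> xyz; exists x, y; split=> //; apply: Rr.
Qed.

Definition quotient_left_zero : Prop :=
  forall A B, eq_classes A -> eq_classes B -> quot_mul A B = A.

Definition is_representatives (X : set S) : Prop :=
  forall A, eq_classes A -> exists! x, X x /\ A x.

End Congruence.

Definition Aut (S : semigroupType) : set (S -> S) :=
  [set g | bijective g /\ {morph g : x y / x * y}].

Record subgroup_Aut (S : semigroupType) (G : set (S -> S)) : Prop := {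
  subgroup_sub : G `<=` @Aut S;
  subgroup_id : G id;
  subgroup_comp : forall g h, G g -> G h -> G (g \o h);
  subgroup_inv : forall g h, G g -> cancel g h -> cancel h g -> G h
}.

Section Action.
Variables (S : Type) (G : set (S -> S)).

Definition stabilizer (x : S) : set (S -> S) := [set g | G g /\ g x = x].

Definition semiregular : Prop := forall x, stabilizer x = [set id].

Definition act_orbit (x : S) : set S := [set g x | g in G].

Definition act_orbits : set (set S) := range act_orbit.

Definition is_block (B : set S) : Prop :=
  forall g, G g -> g @` B = B \/ g @` B `&` B = set0.

(* [P] is meant to be a partition of [S]. *)
Definition block_system (P : set (set S)) : Prop :=
  forall B, P B -> is_block B.

(* [h] is the inverse of [g]. *)
Record theta_spec (T : set S) (theta : S -> S -> S) : Prop := {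
  theta_in : forall x, G (theta x);
  theta_base : forall t, T t -> theta t = id;
  theta_act : forall t g h, T t -> G g -> cancel g h -> cancel h g ->
    theta (g t) = h
}.

End Action.

Definition pent_map (S : semigroupType) (theta : S -> S -> S)
  (p : S * S) : S * S := (p.1 * p.2, theta p.1 p.2).

(* Main.v *)
Require Import Defs.
From mathcomp Require Import all_boot.
From mathcomp Require Import boolp classical_sets.

(** Every orbit of [G] meets the chosen class [T] in exactly one point, and a
    group element is determined by its value at one point (semi-regularity).
    Hence for every [x] there is exactly one [g] in [G] with [T (g x)], and the
    clauses that define [theta] say precisely that [theta x] is this [g]
    ([theta_specP]).  This gives existence and uniqueness of [theta], and it
    turns every identity between values of [theta] into a membership in [T]:

    - [theta (x * y) = theta x] ([theta_mul]): since [S/R] is left-zero,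
      [theta x (x * y) = theta x x * theta x y] is [R]-equivalent to
      [theta x x], hence lies in [T];
    - [theta (g y) \o g = theta y] for [g] in [G] ([theta_cocycle]): the left
      side lies in [G] and sends [y] into [T].

    As the maps [theta x] are automorphisms, these two identities yield the
    pentagon and the commutativity relations; bijectivity of automorphisms is
    non-degeneracy. *)

Lemma quotient_left_zero_mul {S : semigroupType} {R : S -> S -> Prop} :
  congruence R -> quotient_left_zero R -> forall x y : S, R x (x * y)%g.
Proof.
move=> hR hRz x y; have [[Rr _ _] _] := hR.
have := hRz (eq_class R x) (eq_class R y).
rewrite quot_mulE // => -/(_ (imageT _ _) (imageT _ _)) eq_xy.
have : eq_class R (x * y)%g (x * y)%g by apply: Rr.
by rewrite eq_xy.
Qed.

Lemma subgroup_Aut_inv {S : semigroupType} {G : set (S -> S)} :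
  subgroup_Aut G -> forall g, G g -> exists h, [/\ G h, cancel g h & cancel h g].
Proof.
move=> hG g Gg; have [[h gK hK] _] := subgroup_sub hG Gg.
by exists h; split=> //; apply: subgroup_inv gK hK.
Qed.

(** If [g x] and [h x] are both in [T] then they coincide, being in the same
    orbit; so [g^-1 \o h] fixes [x]. *)
Lemma semiregular_into_inj {S : semigroupType} {G : set (S -> S)} {T : set S} :
  subgroup_Aut G -> semiregular G ->
  (forall x, exists! u, act_orbit G x u /\ T u) ->
  forall g h x, G g -> G h -> T (g x) -> T (h x) -> g = h.
Proof.
move=> hG hGs hT g h x Gg Gh Tgx Thx.
have [u [_ uniq_u]] := hT x.
have gh_x : g x = h x.
  rewrite -(uniq_u (g x)); last by split=> //; exists g.
  by apply: uniq_u; split=> //; exists h.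
have [k [Gk gK kK]] := subgroup_Aut_inv hG _ Gg.
have : stabilizer G x (k \o h).
  by split; [apply: subgroup_comp | rewrite /= -gh_x gK].
rewrite hGs => kh_id; apply: funext => y.
by rewrite -[in LHS](congr1 (@^~ y) kh_id) /= kK.
Qed.

(** Writing [x = g t] with [t] in [T], the map [g^-1] prescribed for [theta x]
    is the element of [G] that sends [x] back into [T].  In this form the
    specification no longer refers to a decomposition of [x], so values of
    [theta] can be compared through [semiregular_into_inj]. *)
Lemma theta_specP {S : semigroupType} {G : set (S -> S)} {T : set S} :
  subgroup_Aut G -> semiregular G ->
  (forall x, exists! u, act_orbit G x u /\ T u) ->
  forall theta : S -> S -> S,
  theta_spec G T theta <-> forall x, G (theta x) /\ T (theta x x).
Proof.
move=> hG hGs hT theta; split=> [[Gth _ thE] x | thP].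
  split=> //; have [u [[[g Gg gx_u] Tu] _]] := hT x.
  have [h [Gh gK hK]] := subgroup_Aut_inv hG _ Gg.
  have -> : theta x = g by rewrite -(gK x) gx_u; apply: thE.
  by rewrite gx_u.
have inj := semiregular_into_inj hG hGs hT.
have Gth x : G (theta x) by have [] := thP x.
have Tth x : T (theta x x) by have [] := thP x.
split=> // [t Tt | t g h Tt Gg gK hK].
  exact: (inj _ _ t _ (subgroup_id hG)).
by apply: (inj _ _ (g t)); rewrite ?gK //; apply: subgroup_inv gK hK.
Qed.

Lemma theta_spec_exists_unique {S : semigroupType} {G : set (S -> S)}
    {T : set S} :
  subgroup_Aut G -> semiregular G ->
  (forall x, exists! u, act_orbit G x u /\ T u) ->
  exists! theta : S -> S -> S, theta_spec G T theta.
Proof.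
move=> hG hGs hT.
have ex x : exists g, G g /\ T (g x).
  by have [u [[[g Gg gx_u] Tu] _]] := hT x; exists g; rewrite gx_u.
have [theta thP] := choice ex; exists theta; split.
  exact/(theta_specP hG hGs hT).
move=> theta' /(theta_specP hG hGs hT) th'P; apply: funext => x.
have [[Gx Tx] [Gx' Tx']] := (thP x, th'P x).
exact: (semiregular_into_inj hG hGs hT _ _ x).
Qed.

Lemma theta_cocycle {S : semigroupType} {G : set (S -> S)} {T : set S} :
  subgroup_Aut G -> semiregular G ->
  (forall x, exists! u, act_orbit G x u /\ T u) ->
  forall theta : S -> S -> S, theta_spec G T theta ->
  forall g y, G g -> theta (g y) \o g = theta y.
Proof.
move=> hG hGs hT theta /(theta_specP hG hGs hT) thP g y Gg.
have [[Ggy Tgy] [Gy Ty]] := (thP (g y), thP y).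
by apply: (semiregular_into_inj hG hGs hT _ _ y) => //; apply: subgroup_comp.
Qed.

Lemma theta_mul {S : semigroupType} {G : set (S -> S)} {T : set S} :
  subgroup_Aut G -> semiregular G ->
  (forall x, exists! u, act_orbit G x u /\ T u) ->
  (forall x y, T x -> T (x * y)%g) ->
  forall theta : S -> S -> S, theta_spec G T theta ->
  forall x y, theta (x * y)%g = theta x.
Proof.
move=> hG hGs hT TM theta /(theta_specP hG hGs hT) thP x y.
have [[Gxy Txy] [Gx Tx]] := (thP (x * y)%g, thP x).
apply: (semiregular_into_inj hG hGs hT _ _ (x * y)%g) => //.
by have [_ ->] := subgroup_sub hG Gx; apply: TM.
Qed.

(* [exists! theta, theta_spec G T theta] is the assertion, implicit in the
   definition of theta, that the given clauses define a map S -> G. *)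
Theorem theorem9 (S : semigroupType) (hS : weak_commutative S)
  (R : S -> S -> Prop) (hR : congruence R) (hRz : quotient_left_zero R)
  (G : set (S -> S)) (hG : subgroup_Aut G) (hGs : semiregular G)
  (hrep : forall O : set S, act_orbits G O -> is_representatives R O)
  (hblock : block_system G (eq_classes R))
  (T : set S) (hT : eq_classes R T) :
  (exists! theta : S -> S -> S, theta_spec G T theta) /\
  forall theta : S -> S -> S, theta_spec G T theta ->
    [/\ pentagon_solution (pent_map theta),
        commutative_solution (pent_map theta) &
        nondegenerate_solution (pent_map theta)].
Proof.
have orbT x : exists! u, act_orbit G x u /\ T u.
  by apply: (hrep (act_orbit G x)) => //; apply: imageT.
split=> [|theta th]; first exact: theta_spec_exists_unique.
have TM x y : T x -> T (x * y)%g.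
  have [e _ <-] := hT; have [[_ _ Rt] _] := hR.
  by move=> ex; apply: Rt ex (quotient_left_zero_mul hR hRz x y).
have Gth x : G (theta x) by case: th.
have thM x : {morph theta x : y z / (y * z)%g}.
  by have [] := subgroup_sub hG (Gth x).
have th_mul := theta_mul hG hGs orbT TM theta th.
have th_comp x y z : theta (theta x y) (theta x z) = theta y z.
  by rewrite -(theta_cocycle hG hGs orbT theta th (theta x) y (Gth x)).
split.
- split; first by have [e _ _] := hT; exists; exact: e.
  case=> [[x y] z]; rewrite /s12 /s23 /s13 /pair_id /id_pair /pent_map /=.
  by rewrite th_mul th_comp thM mulgA.
- case=> [[x y] z]; rewrite /s12 /s13 /pair_id /id_pair /pent_map /=.
  by rewrite !th_mul hS.
- by move=> x; have [] := subgroup_sub hG (Gth x).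
Qed.
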